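(* Let $\mathcal{S}\subset\mathbb{R}^3$ be a simplicial surface with set of triangular faces $\mathcal{F}(\mathcal{S})$, and let $f:\mathcal{S}\to\mathbb{R}^2$ be a simplicial (piecewise affine) mapping with $|f(\mathcal{S})|>0$. Then the normalized authalic energy $$\widetilde{E}_A(f)=\frac{1}{2}\,\mathbf{f}^\top\big(I_2\otimes \widetilde{L_S}(f)\big)\mathbf{f}-\mathcal{A}(f)$$ satisfies $\widetilde{E}_A(f)\ge 0$, and equality holds if and only if $f$ is area-preserving.
   Context: A simplicial surface $\mathcal{S}\subset\mathbb{R}^3$ is the underlying set of a finite simplicial 2-complex with vertices $v_1,\dots,v_n\in\mathbb{R}^3$, set $\mathcal{F}(\mathcal{S})$ of (nondegenerate, oriented) triangular faces $[v_i,v_j,v_k]$, and set $\mathcal{E}(\mathcal{S})$ of edges, the edges being the edges of the faces. $|\tau|$ denotes the area of a triangle $\tau$, and $|\mathcal{S}|=\sum_{\tau\in\mathcal{F}(\mathcal{S})}|\tau|$. A simplicial mapping $f:\mathcal{S}\to\mathbb{R}^2$ is a mapping that is affine on each face; it is determined by the vertex images $f(v_i)=(f_i^1,f_i^2)^\top$ and is represented by the vector $\mathbf{f}=(f_1^1,\dots,f_n^1,f_1^2,\dots,f_n^2)^\top\in\mathbb{R}^{2n}$. The image area is $\mathcal{A}(f)=|f(\mathcal{S})|=\sum_{\tau\in\mathcal{F}(\mathcal{S})}|f(\tau)|$. The matrix $\widetilde{L_S}(f)\in\mathbb{R}^{n\times n}$ is the weighted Laplacian $$[\widetilde{L_S}(f)]_{i,j}=\begin{cases}-\sum_{[v_i,v_j,v_k]\in\mathcal{F}(\mathcal{S})}[\widetilde{\omega_S}(f)]_{i,j,k}&\text{if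 }[v_i,v_j]\in\mathcal{E}(\mathcal{S}),\\ -\sum_{\ell\ne i}[\widetilde{L_S}(f)]_{i,\ell}&\text{if }j=i,\\ 0&\text{otherwise,}\end{cases}$$ where the first sum is over all faces containing the edge $[v_i,v_j]$ ($v_k$ being the third vertex), with $$[\widetilde{\omega_S}(f)]_{i,j,k}=\frac{|\mathcal{S}|}{|f(\mathcal{S})|}\cdot\frac{\cot(\theta_{i,j}^k(f))\,|f([v_i,v_j,v_k])|}{2\,|[v_i,v_j,v_k]|},$$ where $\theta_{i,j}^k(f)$ is the angle at $f(v_k)$ opposite to the edge $[f(v_i),f(v_j)]$ in the image triangle. The product $\cot(\theta_{i,j}^k(f))\,|f([v_i,v_j,v_k])|$ equals $\tfrac12 (f(v_i)-f(v_k))^\top(f(v_j)-f(v_k))$, which is taken as its meaning if the image triangle is degenerate. $f$ is called area-preserving if it preserves local area up to a global scaling factor, i.e. the ratio $|f(\tau)|/|\tau|$ is the same constant for all $\tau\in\mathcal{F}(\mathcal{S})$. *)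

(* Defs.v *)
From HB Require Import structures.
From mathcomp Require Import all_boot all_order all_algebra.
From mathcomp Require Import mathcomp_extra boolp classical_sets reals trigo.
From mathcomp Require Import mxtens.
Set Implicit Arguments.
Unset Strict Implicit.
Unset Printing Implicit Defensive.
Import Order.TTheory GRing.Theory Num.Theory.
Local Open Scope ring_scope.

Section Geometry.
Context {R : realType} {d : nat}.
Implicit Types p q r : 'cV[R]_d.

Definition dot p q : R := (p^T *m q) 0 0.

(* The norm that MathComp-Analysis puts on matrices is the sup norm. *)
Definition enorm p : R := Num.sqrt (dot p p).

(* |p - r| |q - r| sin(angle) / 2, written through the Gram determinant so that
   it applies in any dimension. *)
Definition triangle_area p q r : R :=
  Num.sqrt (dot (p - r) (p - r) * dot (q - r) (q - r) - dot (p - r) (q - r) ^+ 2)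
    / 2.

(* The angle at [r], opposite to the edge [p, q]. *)
Definition opposite_angle p q r : R :=
  acos (dot (p - r) (q - r) / (enorm (p - r) * enorm (q - r))).

Definition cot (x : R) : R := cos x / sin x.

(* cot(angle at r) * area, extended to degenerate triangles. *)
Definition cot_area p q r : R :=
  if triangle_area p q r == 0 then dot (p - r) (q - r) / 2
  else cot (opposite_angle p q r) * triangle_area p q r.

Definition conv n (v : 'I_n -> 'cV[R]_d) (s : {set 'I_n}) : set 'cV[R]_d :=
  [set x | exists c : 'I_n -> R,
    [/\ forall i, 0 <= c i, forall i, i \notin s -> c i = 0,
        \sum_i c i = 1 & x = \sum_i c i *: v i]]%classic.

End Geometry.

Definition supp n (t : 'I_n * 'I_n * 'I_n) : {set 'I_n} :=
  [set t.1.1; t.1.2; t.2].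

Definition simplices n (F : {set 'I_n * 'I_n * 'I_n}) : {set {set 'I_n}} :=
  [set s : {set 'I_n} | (s != finset.set0) &&
    ((#|s| == 1)%N || [exists t in F, s \subset supp t])].

(* A face is an ordered triple of vertex indices, the order giving its
   orientation; [face_inj] says that each triangle is listed once.  The last
   field is the defining condition of a geometric simplicial complex: two
   simplices meet in a common face or not at all ([conv] of [set0] is empty).
   Nondegeneracy of a face makes its vertices distinct and its edges proper. *)
Record simplicial_surface (R : realType) (n : nat) := SimplicialSurface {
  vertex : 'I_n -> 'cV[R]_3;
  faces : {set 'I_n * 'I_n * 'I_n};
  face_inj : {in faces &, injective (@supp n)};
  face_nondegenerate : forall t, t \in faces ->
    0 < triangle_area (vertex t.1.1) (vertex t.1.2) (vertex t.2);
  simplices_meet : forall s s',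
    s \in simplices faces -> s' \in simplices faces ->
    (conv vertex s `&` conv vertex s' = conv vertex (s :&: s'))%classic }.

Section Surface.
Context {R : realType} {n : nat}.
Variable S : simplicial_surface R n.
Local Notation v := (vertex S).

Definition is_face (s : {set 'I_n}) : bool := [exists t in faces S, supp t == s].

Definition is_edge (i j : 'I_n) : bool :=
  (i != j) && [exists t in faces S, (i \in supp t) && (j \in supp t)].

Definition face_area (t : 'I_n * 'I_n * 'I_n) : R :=
  triangle_area (v t.1.1) (v t.1.2) (v t.2).

Definition surface_area : R := \sum_(t in faces S) face_area t.

(* Only the values of [f] on the surface are constrained or used. *)
Variable f : 'cV[R]_3 -> 'cV[R]_2.

Definition simplicial_map : Prop :=
  forall t, t \in faces S -> forall x y : 'cV[R]_3,
    conv v (supp t) x -> conv v (supp t) y -> forall l : R, 0 <= l <= 1 ->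
    f (l *: x + (1 - l) *: y) = l *: f x + (1 - l) *: f y.

(* The image of a face under a simplicial map is the triangle spanned by the
   images of its vertices. *)
Definition image_face_area (t : 'I_n * 'I_n * 'I_n) : R :=
  triangle_area (f (v t.1.1)) (f (v t.1.2)) (f (v t.2)).

Definition image_area : R := \sum_(t in faces S) image_face_area t.

Definition stretch_weight (i j k : 'I_n) : R :=
  surface_area / image_area *
  (cot_area (f (v i)) (f (v j)) (f (v k)) /
   (2 * triangle_area (v i) (v j) (v k))).

Definition laplacian_offdiag (i j : 'I_n) : R :=
  if is_edge i j
  then - \sum_(k | is_face [set i; j; k]) stretch_weight i j k
  else 0.

Definition stretch_laplacian : 'M[R]_n :=
  \matrix_(i, j) (if j == i then - \sum_(l | l != i) laplacian_offdiag i l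
                  else laplacian_offdiag i j).

(* All first coordinates, then all second coordinates. *)
Definition coord_vec : 'cV[R]_(2 * n) :=
  \col_p f (v (mxtens_unindex p).2) (mxtens_unindex p).1 0.

Definition normalized_authalic_energy : R :=
  2^-1 * (coord_vec^T *m ((1%:M : 'M[R]_2) *t stretch_laplacian) *m coord_vec) 0 0
  - image_area.

Definition area_preserving : Prop :=
  exists c : R, forall t, t \in faces S -> image_face_area t / face_area t = c.

End Surface.

(* Main.v *)
(* For an ordering (i, j, k) of a face, cot(theta_ij^k) * area is half a dot
   product, and summing (f_i - f_k).(f_j - f_k) |f_i - f_j|^2 over the three
   edges of a triangle gives 8 times its squared area.  Hence the quadratic form
   of the energy is 2 |S| / A(f) * \sum_t |f(t)|^2 / |t|, and completing the
   square,
     E(f) = |S| / A(f) * \sum_t |t| (|f(t)| / |t| - A(f) / |S|)^2. *)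
Require Import Defs.
From mathcomp Require Import all_boot all_order all_algebra reals.
From mathcomp Require Import trigo ring lra mxtens.
Import Order.TTheory GRing.Theory Num.Theory.
Local Open Scope ring_scope.

(** * Dot products, triangle areas and cotangents *)

Section Dot.
Context {R : realType} {d : nat}.
Implicit Types p q r : 'cV[R]_d.

Lemma dotE p q : dot p q = \sum_i p i 0 * q i 0.
Proof. by rewrite /dot mxE; apply: eq_bigr => i _; rewrite mxE. Qed.

Lemma dotC p q : dot p q = dot q p.
Proof. by rewrite !dotE; apply: eq_bigr => i _; rewrite mulrC. Qed.

Lemma dotBl p q r : dot (p - q) r = dot p r - dot q r.
Proof.
by rewrite !dotE -sumrB; apply: eq_bigr => i _; rewrite !mxE mulrBl.
Qed.

Lemma dotBr p q r : dot r (p - q) = dot r p - dot r q.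
Proof. by rewrite dotC dotBl !(dotC r). Qed.

Lemma dotZl a p q : dot (a *: p) q = a * dot p q.
Proof.
by rewrite !dotE mulr_sumr; apply: eq_bigr => i _; rewrite !mxE mulrA.
Qed.

Lemma dotZr a p q : dot p (a *: q) = a * dot p q.
Proof. by rewrite dotC dotZl dotC. Qed.

Lemma dot_ge0 p : 0 <= dot p p.
Proof. by rewrite dotE sumr_ge0 // => i _; rewrite -expr2 sqr_ge0. Qed.

Lemma dot_eq0 p : dot p p = 0 -> p = 0.
Proof.
rewrite dotE => /eqP; rewrite psumr_eq0 => [/allP p0|i _]; last first.
  by rewrite -expr2 sqr_ge0.
apply/colP => i; rewrite mxE; apply/eqP.
by have := p0 i (mem_index_enum i); rewrite mulf_eq0 orbb.
Qed.

(** Cauchy-Schwarz: multiplied by [dot q q], the Gram determinant is the squared norm of a multiple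
    of the part of [p] orthogonal to [q]. *)
Lemma gram_ge0 p q : 0 <= dot p p * dot q q - dot p q ^+ 2.
Proof.
have [/dot_eq0 ->|q_neq0] := eqVneq (dot q q) 0.
  by rewrite -(scale0r 0) !dotZr !mul0r expr0n mulr0 subr0.
have q_gt0 : 0 < dot q q by rewrite lt_def q_neq0 dot_ge0.
rewrite -(pmulr_rge0 _ q_gt0).
have -> : dot q q * (dot p p * dot q q - dot p q ^+ 2) =
    dot (dot q q *: p - dot p q *: q) (dot q q *: p - dot p q *: q).
  rewrite !(dotBl, dotBr, dotZl, dotZr) (dotC q p); ring.
exact: dot_ge0.
Qed.

Lemma triangle_area_ge0 p q r : 0 <= triangle_area p q r.
Proof. by rewrite divr_ge0 ?sqrtr_ge0. Qed.

Lemma triangle_area_degenerate p r : triangle_area p p r = 0.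
Proof. by rewrite /triangle_area -expr2 subrr sqrtr0 mul0r. Qed.

Lemma triangle_areaC p q r : triangle_area q p r = triangle_area p q r.
Proof.
by rewrite /triangle_area (dotC (q - r) (p - r)) (mulrC (dot (q - r) _)).
Qed.

Lemma triangle_area_rot p q r : triangle_area q r p = triangle_area p q r.
Proof.
congr (Num.sqrt _ / 2).
rewrite !(dotBl, dotBr) (dotC q p) (dotC r p) (dotC r q); ring.
Qed.

(** Let [P] be the product of the side lengths at [r] and [z] the dot product there. The cosine is
    [z / P], the sine is the root of [P ^+ 2 - z ^+ 2] over [P], and the area is half that root,
    which cancels. *)
Lemma cot_areaE p q r : cot_area p q r = dot (p - r) (q - r) / 2.
Proof.
rewrite /cot_area; case: eqVneq => // area_neq0.
have gram_gt0 : 0 < dot (p - r) (p - r) * dot (q - r) (q - r)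
                    - dot (p - r) (q - r) ^+ 2.
  rewrite lt_def gram_ge0 andbT; apply: contra_neq area_neq0 => gram0.
  by rewrite /triangle_area gram0 sqrtr0 mul0r.
rewrite /opposite_angle /cot /triangle_area /enorm.
have [X0 Y0] := (dot_ge0 (p - r), dot_ge0 (q - r)).
move: (dot (p - r) (p - r)) (dot (q - r) (q - r)) (dot (p - r) (q - r))
  gram_gt0 X0 Y0 => X Y z gram_gt0 X0 Y0.
rewrite -sqrtrM //; set P := Num.sqrt (X * Y).
have XYE : X * Y = P ^+ 2 by rewrite sqr_sqrtr // mulr_ge0.
have P_gt0 : 0 < P by rewrite sqrtr_gt0; nra.
rewrite XYE in gram_gt0 *.
(* Cauchy-Schwarz puts the cosine in [-1, 1], where [acos] inverts [cos]. *)
have u_lt1 : `|z / P| <= 1.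
  rewrite normrM normfV (gtr0_norm P_gt0) ler_pdivrMr // mul1r.
  by rewrite -ler_sqr ?nnegrE ?(ltW P_gt0) // real_normK ?num_real //; lra.
rewrite ler_norml in u_lt1; rewrite sin_acos // acosK; last first.
  by rewrite in_itv.
have -> : 1 - (z / P) ^+ 2 = (P ^+ 2 - z ^+ 2) / P ^+ 2.
  by field; rewrite gt_eqF.
rewrite sqrtrM ?ltW // sqrtrV ?sqr_ge0 // sqrtr_sqr gtr0_norm //.
have s_gt0 : 0 < Num.sqrt (P ^+ 2 - z ^+ 2) by rewrite sqrtr_gt0.
by field; rewrite !gt_eqF.
Qed.

(** Squared edge lengths weighted by the opposite cotangents sum to four times the area. Multiplying
    by the area turns the cotangents into dot products, which covers degenerate triangles too. *)
Lemma triangle_area_sqr p q r :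
  8 * triangle_area p q r ^+ 2 =
  dot (p - r) (q - r) * dot (p - q) (p - q)
  + dot (q - p) (r - p) * dot (q - r) (q - r)
  + dot (r - q) (p - q) * dot (r - p) (r - p).
Proof.
rewrite /triangle_area expr_div_n sqr_sqrtr ?gram_ge0 //.
rewrite !(dotBl, dotBr) (dotC q p) (dotC r p) (dotC r q);
  by field.
Qed.

End Dot.

(** * Ordered triples with a given vertex set *)

Section Orderings.
Context {n : nat}.
Implicit Types t p : 'I_n * 'I_n * 'I_n.

(** Consecutive pairs share the last vertex and reverse the edge opposite to it. *)
Definition orderings t : seq ('I_n * 'I_n * 'I_n) :=
  let: (i, j, k) := t in
  [:: (i, j, k); (j, i, k); (j, k, i); (k, j, i); (k, i, j); (i, k, j)].

Definition distinct t := [&& t.1.1 != t.1.2, t.1.1 != t.2 & t.1.2 != t.2].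

Lemma orderings_uniq t : distinct t -> uniq (orderings t).
Proof.
case: t => [[i j] k] /and3P[/= ij ik jk].
rewrite !inE !xpair_eqE !(eq_sym j i) !(eq_sym k i) !(eq_sym k j).
by rewrite (negPf ij) (negPf ik) (negPf jk) !(andbF, andFb).
Qed.

Lemma card_supp t : distinct t -> #|supp t| = 3.
Proof.
case: t => [[i j] k] /and3P[/= ij ik jk].
by rewrite /supp /= setUC cardsU1 !inE negb_or cards2 ij !(eq_sym k) ik jk.
Qed.

Lemma supp_distinct t p : distinct t -> supp p = supp t -> distinct p.
Proof.
move=> /card_supp; case: p => [[a b] c] + pt; rewrite -{}pt /supp /distinct /=.
by rewrite setUC cardsU1 !inE cards2 !(eq_sym c);
  do 3 case: eqP => //= _.
Qed.

Lemma supp_eqE t p : distinct t -> (supp p == supp t) = (p \in orderings t).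
Proof.
move=> dt; apply/eqP/idP => [pt|]; last first.
  case: t {dt} => [[i j] k]; rewrite !inE /supp => pE.
  apply/setP => x; rewrite !inE.
  have orE (a b c : bool) : [/\ b || a || c = a || b || c, b || c || a = a || b || c,
      c || b || a = a || b || c, c || a || b = a || b || c
    & a || c || b = a || b || c] by split; case: a b c => [] [] [].
  have [ba bca cba cab acb] := orE (x == i) (x == j) (x == k).
  by case/orP: pE => [|/orP[|/orP[|/orP[|/orP[]]]]] /eqP->.
have /and3P[] := supp_distinct _ _ dt pt.
case: p t dt pt => [[a b] c] [[i j] k] _ /setP pt /=.
have := pt a; have := pt b; have := pt c.
rewrite /supp !inE /= !eqxx !(orbT, orTb).
(* Each entry of [p] is one of [i], [j], [k]. Of the 27 cases, those with a repetition contradict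
   distinctness and the other six are the orderings. *)
by move=> /esym/orP[/orP[]|]/eqP-> /esym/orP[/orP[]|]/eqP->
  /esym/orP[/orP[]|]/eqP->; rewrite ?eqxx ?orbT.
Qed.

End Orderings.

(** * From the quadratic form to a sum of squares over faces *)

Section Energy.
Context {R : realType} {n : nat}.
Variable S : simplicial_surface R n.
Local Notation v := (vertex S).

Lemma face_area_gt0 t : t \in faces S -> 0 < face_area S t.
Proof. exact: face_nondegenerate. Qed.

Lemma face_distinct t : t \in faces S -> distinct t.
Proof.
move=> /face_nondegenerate; case: t => [[i j] k] /= area_gt0.
apply/and3P; split; apply: contraTneq area_gt0 => /= ->.
- by rewrite triangle_area_degenerate ltxx.
- by rewrite triangle_area_rot triangle_area_degenerate ltxx.
- by rewrite -triangle_area_rot triangle_area_degenerate ltxx.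
Qed.

(** Double counting of the ordered triples supported on a face: each one is an ordering of exactly
    one listed face. *)
Lemma sum_is_face (g : 'I_n -> 'I_n -> 'I_n -> R) :
  \sum_i \sum_j \sum_(k | is_face S [set i; j; k]) g i j k =
  \sum_(t in faces S) \sum_(p <- orderings t) g p.1.1 p.1.2 p.2.
Proof.
rewrite pair_big /= pair_big_dep /=.
under [RHS]eq_bigr => t tF.
  rewrite big_uniq ?orderings_uniq ?face_distinct //=.
  under eq_bigl => p do rewrite -supp_eqE ?face_distinct //.
  over.
rewrite (exchange_big_dep (fun p => is_face S (supp p))) /=; last first.
  by move=> t p tF /eqP ->; apply/exists_inP; exists t.
apply: eq_bigr => p /exists_inP[t tF /eqP tp].
(* Uniqueness of the face with support [supp p] is [face_inj]. *)
rewrite (big_pred1 t) // => t'; apply/andP/eqP => [[t'F /eqP pt']|->].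
  by apply: (@face_inj _ _ S) => //; rewrite tp.
by rewrite tp.
Qed.

Variable f : 'cV[R]_3 -> 'cV[R]_2.
Local Notation w := (stretch_weight S f).
Local Notation L := (stretch_laplacian S f).

Lemma is_face_edge i j k : is_face S [set i; j; k] -> is_edge S i j.
Proof.
move=> /exists_inP[t tF /eqP tE]; apply/andP; split; last first.
  by apply/exists_inP; exists t => //; rewrite tE !inE !eqxx ?orbT.
have /esym /(supp_distinct _ (i, j, k)) := tE.
by move=> /(_ (face_distinct _ tF)) /and3P[].
Qed.

(** Off the edges, and for [i = j], the sum is empty, so the case distinction disappears. *)
Lemma laplacian_offdiagE i j :
  laplacian_offdiag S f i j = - \sum_(k | is_face S [set i; j; k]) w i j k.
Proof.
rewrite /laplacian_offdiag; case: ifPn => // /negP not_edge.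
rewrite big_pred0 ?oppr0 // => k.
by apply: contra_notF not_edge => /is_face_edge.
Qed.

(** Rows of the Laplacian sum to zero, so [x i] may be subtracted from every [x j]. *)
Lemma stretch_laplacian_mul (x : 'I_n -> R) i :
  \sum_j L i j * x j = \sum_j laplacian_offdiag S f i j * (x j - x i).
Proof.
rewrite (bigD1 i) //= mxE eqxx [RHS](bigD1 i) //= subrr mulr0 add0r.
rewrite mulNr mulr_suml -sumrN -big_split /=.
by apply: eq_bigr => j ji; rewrite mxE (negPf ji); ring.
Qed.

(** The Kronecker product is block diagonal with one copy of [L] per coordinate; adding the two
    coordinates produces the dot product. *)
Lemma coord_vec_quad :
  ((coord_vec S f)^T *m ((1%:M : 'M[R]_2) *t L) *m coord_vec S f) 0 0 =
  \sum_i \sum_j L i j * dot (f (v i)) (f (v j)).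
Proof.
have reindexE (F : 'I_(2 * n) -> R) :
    \sum_p F p = \sum_c \sum_i F (mxtens_index (c, i)).
  rewrite pair_big /= (reindex (@mxtens_index 2 n)) /=.
    by apply: eq_bigr => -[].
  by exists (@mxtens_unindex 2 n) => p _; rewrite ?mxtens_indexK ?mxtens_unindexK.
rewrite -mulmxA mxE reindexE exchange_big /=; apply: eq_bigr => i _.
under [RHS]eq_bigr => j _ do rewrite dotE mulr_sumr.
rewrite [RHS]exchange_big /=; apply: eq_bigr => c _.
rewrite !mxE mxtens_indexK /= reindexE (bigD1 c) //= [X in _ * (_ + X)]big1 ?addr0 => [|c' cc'].
  rewrite mulr_sumr; apply: eq_bigr => j _.
  by rewrite tensmxE !mxE mxtens_indexK eqxx mul1r mulrCA.
by apply: big1 => j _; rewrite tensmxE !mxE (eq_sym c) (negPf cc') !mul0r.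
Qed.

(** The two orientations of an edge carry the same weight, and their dot products add up to its
    squared image length; [triangle_area_sqr] then sums the three edges. *)
Lemma sum_orderings_weight t :
  \sum_(p <- orderings t)
     w p.1.1 p.1.2 p.2 *
     dot (f (v p.1.1)) (f (v p.1.1) - f (v p.1.2)) =
  2 * (surface_area S / image_area S f) *
  (image_face_area S f t ^+ 2 / face_area S t).
Proof.
case: t => [[i j] k]; rewrite /orderings !big_cons big_nil /=.
rewrite /image_face_area /face_area /stretch_weight !cot_areaE /=.
set c := surface_area S / _.
rewrite (triangle_areaC (v i) (v j)) (triangle_areaC (v k) (v i)).
rewrite (triangle_areaC (v j) (v k)).
rewrite (triangle_area_rot (v j) (v k)) (triangle_area_rot (v i) (v j)).
set s := triangle_area (v i) _ _; set a := triangle_area (f _) _ _.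
have -> : a ^+ 2 = 8 * a ^+ 2 / 8 by field.
(* Both sides are linear in the inverse domain area, which becomes a variable so that [field] meets
   no condition on it. *)
rewrite /a triangle_area_sqr invfM; move: (s^-1) => s'.
rewrite !(dotBl, dotBr) (dotC (f (v j)) (f (v i))) (dotC (f (v k)) (f (v i))).
by rewrite (dotC (f (v k)) (f (v j))); field.
Qed.

Lemma energyE :
  normalized_authalic_energy S f =
  surface_area S / image_area S f *
    (\sum_(t in faces S) image_face_area S f t ^+ 2 / face_area S t)
  - image_area S f.
Proof.
rewrite /normalized_authalic_energy coord_vec_quad; congr (_ - _).
have -> : \sum_i \sum_j L i j * dot (f (v i)) (f (v j)) =
    \sum_i \sum_j \sum_(k | is_face S [set i; j; k])
      w i j k * dot (f (v i)) (f (v i) - f (v j)).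
  apply: eq_bigr => i _.
  rewrite (stretch_laplacian_mul (fun j => dot (f (v i)) (f (v j)))).
  apply: eq_bigr => j _; rewrite laplacian_offdiagE -mulr_suml dotBr; ring.
rewrite sum_is_face; under eq_bigr do rewrite sum_orderings_weight.
by rewrite -mulr_sumr !mulrA mulVf ?mul1r ?pnatr_eq0.
Qed.

(** With [r] the mean ratio, the cross term sums to -2 r A(f) and the constant term to r^2 |S| = r
    A(f), leaving -A(f) after scaling by 1 / r. *)
Lemma energy_sum_sqr : surface_area S != 0 -> image_area S f != 0 ->
  normalized_authalic_energy S f =
  surface_area S / image_area S f *
    \sum_(t in faces S) face_area S t *
      (image_face_area S f t / face_area S t
       - image_area S f / surface_area S) ^+ 2.
Proof.
move=> S_neq0 A_neq0; rewrite energyE.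
set r := image_area S f / surface_area S.
have -> : \sum_(t in faces S) face_area S t *
      (image_face_area S f t / face_area S t - r) ^+ 2 =
    \sum_(t in faces S) (image_face_area S f t ^+ 2 / face_area S t
       - 2 * r * image_face_area S f t + r ^+ 2 * face_area S t).
  apply: eq_bigr => t /face_area_gt0 t_gt0; field; by rewrite gt_eqF.
rewrite big_split sumrB -!mulr_sumr /= -/(image_area S f) -/(surface_area S).
by rewrite /r; field; rewrite S_neq0 A_neq0.
Qed.

Lemma surface_area_gt0 : 0 < image_area S f -> 0 < surface_area S.
Proof.
move=> A_gt0; have [t tF] : exists t, t \in faces S.
  apply/set0Pn; apply: contraTneq A_gt0 => F0.
  by rewrite /image_area F0 big_set0 ltxx.
rewrite /surface_area (bigD1 t) //= ltr_wpDr ?face_area_gt0 //.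
by apply: sumr_ge0 => t' _; apply: triangle_area_ge0.
Qed.

End Energy.

(** * Nonnegativity and the equality case *)

Theorem theorem1 (R : realType) (n : nat) (S : simplicial_surface R n)
    (f : 'cV[R]_3 -> 'cV[R]_2) (f_simplicial : simplicial_map S f)
    (f_area_gt0 : 0 < image_area S f) :
  0 <= normalized_authalic_energy S f /\
  (normalized_authalic_energy S f = 0 <-> area_preserving S f).
Proof.
have S_gt0 := surface_area_gt0 S f f_area_gt0.
rewrite energy_sum_sqr ?gt_eqF //.
have term_ge0 t : t \in faces S -> 0 <= face_area S t *
    (image_face_area S f t / face_area S t
     - image_area S f / surface_area S) ^+ 2.
  by move=> tF; rewrite mulr_ge0 ?sqr_ge0 ?triangle_area_ge0.
split; first by rewrite mulr_ge0 ?sumr_ge0 // divr_ge0 // ltW.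
split=> [/eqP|[c cE]].
  rewrite mulf_eq0 gt_eqF ?divr_gt0 //= psumr_eq0 // => /allP sum0.
  (* Every square vanishes, since its coefficient is a positive face area; the common ratio is thus
     the mean one. *)
  exists (image_area S f / surface_area S) => t tF.
  have /implyP/(_ tF) := sum0 t (mem_index_enum t).
  by rewrite mulf_eq0 gt_eqF ?face_area_gt0 //= sqrf_eq0 subr_eq0 => /eqP.
(* Summing |f(t)| = c |t| over the faces identifies [c] with the mean ratio. *)
have -> : image_area S f / surface_area S = c.
  apply: (canLR (mulfK _)); first by rewrite gt_eqF.
  rewrite /surface_area mulr_sumr; apply: eq_bigr => t tF.
  by rewrite -(cE t tF) divfK ?gt_eqF ?face_area_gt0.
by rewrite big1 ?mulr0 // => t tF; rewrite cE // subrr expr0n mulr0.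
Qed.
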